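(* Assume that $\Gamma:[0,\infty)\to\mathbb{R}$, $\Gamma(s)=\int_s^\infty \mathbb{E}[g(X_t,t)g(X_s,s)]\,dt$, is a non-negative, strictly decreasing, smooth function. For any $w>0$, when $m>0$ is sufficiently small (i.e. for all $0<m<m_0$ for some $m_0=m_0(w)>0$), $$U_w(I_m^r)<U_w(I_m^f).$$
   Context: $X=\{X_t:t\ge0\}$ is a stochastic process on a metric space $\mathcal{X}$, and $g:\mathcal{X}\times\mathbb{R}_+\to\mathbb{R}$ is such that $(t,\omega)\mapsto g(X_t(\omega),t)$ is jointly measurable; $\alpha:=\mathbb{E}\left[\int_0^\infty g(X_s,s)\,ds\right]$. $\mathcal{M}(\mathbb{R}^+)$ denotes the set of probability distributions $Q$ of a random variable $N$, independent of $X$, with $Q(N\ge0)=1$ and $Q(N>s)>0$ for all $s\in[0,\infty)$. For an estimator $I$ of $\alpha$ and a weight $w\ge0$, the utility is $U_w(I):=-(\mathbb{E}[I]-\alpha)^2-w\operatorname{Var}(I)$. For a budget $m>0$, the fixed truncation estimator is $I_m^f:=\int_0^m g(X_s,s)\,ds$. The optimal randomized estimator $I_m^r$ is $\int_0^N\frac{g(X_s,s)}{Q^*(N>s)}\,ds$ where $Q^*$ minimizes $\operatorname{Var}\left(\int_0^N\frac{g(X_s,s)}{Q(N>s)}\,ds\right)$ over all $Q\in\mathcal{M}(\mathbb{R}^+)$ with $\mathbb{E}^Q[N]=m$; it is unbiased, so $U_w(I_m^r)=-w\inf_{Q\in\mathcal{M}(\mathbb{R}^+):\,\mathbb{E}^Q[N]=m}\operatorname{Var}\left(\int_0^N\frac{g(X_s,s)}{Q(N>s)}\,ds\right)$.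 Standing integrability assumption (all expectations and variances considered are finite and well-defined): the integral defining $\Gamma(s)$ converges absolutely for every $s\ge0$; $$\int_0^\infty\frac{1}{\sqrt{\Gamma(s)}}\int_s^\infty\mathbb{E}\big|g(X_s,s)g(X_t,t)\big|\,dt\,ds<\infty$$ (which implies $\int_0^\infty\sqrt{\Gamma(s)}\,ds<\infty$ and $\mathbb{E}[(\int_0^\infty|g(X_s,s)|ds)^2]<\infty$); and the infimum of the variance is taken over those $Q$ for which $\mathbb{E}\big[\big(\int_0^\infty|g(X_s,s)|\frac{1_{\{N>s\}}}{Q(N>s)}ds\big)^2\big]<\infty$. *)

(* Defs.v *)
From HB Require Import structures.
From mathcomp Require Import all_boot all_order all_algebra.
From mathcomp Require Import all_classical all_reals all_analysis.

Set Implicit Arguments.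
Unset Strict Implicit.
Unset Printing Implicit Defensive.

Import Order.TTheory GRing.Theory Num.Theory.
Import numFieldNormedType.Exports.

Local Open Scope classical_set_scope.
Local Open Scope ring_scope.

(* Processes are indexed by all of R, but only their values at times t >= 0
   are ever used. *)

(* Borel measurability of every X_t, t >= 0. *)
Definition is_process (R : realType) d (T : measurableType d)
    (S : metricType R) (X : R -> T -> S) : Prop :=
  forall t, 0 <= t -> forall B : set S, <<s @open S >> B ->
    measurable (X t @^-1` B).

(* C^oo on the closed half-line: the derivatives D n of all orders exist, as
   one-sided derivatives at the endpoint 0. The library's [derive1n] is not
   used because at 0 it depends on the values of f at negative points. *)
Definition smooth_halfline (R : realType) (f : R -> R) : Prop :=
  exists D : nat -> R -> R,
    (forall s, 0 <= s -> D 0%N s = f s) /\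
    (forall n s, 0 <= s ->
      (fun t => (D n t - D n s) / (t - s)) @ within `[0, +oo[ s^'
        --> D n.+1 s).

Section truncation.
Context (R : realType) d (T : measurableType d) (P : probability T R).
Context (S : Type) (X : R -> T -> S) (g : S -> R -> R).

Local Notation mu := (@lebesgue_measure R).
Local Notation law := (probability (measurableTypeR R) R).

Definition gX (s : R) (x : T) : R := g (X s x) s.

Definition jointly_measurable : Prop :=
  measurable_fun (`[0, +oo[ `*` setT : set (measurableTypeR R * T))
    (fun z : measurableTypeR R * T => gX z.1 z.2).

Definition alpha : \bar R :=
  'E_P[fun x => (\int[mu]_(s in `[0, +oo[) gX s x)%R]%E.

Definition Gamma_integrand (s t : R) : \bar R :=
  'E_P[fun x => (gX t x * gX s x)%R]%E.

Definition Gamma (s : R) : R :=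
  fine (\int[mu]_(t in `[s, +oo[) Gamma_integrand s t)%E.

Definition standing_integrability : Prop :=
  (forall s, 0 <= s -> mu.-integrable `[s, +oo[ (Gamma_integrand s)) /\
  (\int[mu]_(s in `[0%R, +oo[)
     (((Num.sqrt (Gamma s))^-1)%:E *
      \int[mu]_(t in `[s, +oo[) \int[P]_x (`|gX s x * gX t x|%R)%:E)
   < +oo)%E.

(* [Omega] may differ from [T]: a randomized estimator lives on a larger
   probability space. *)
Definition utility dO (Omega : measurableType dO) (Pr : probability Omega R)
    (w : R) (I : Omega -> R) : \bar R :=
  (- ('E_Pr[I] - alpha) ^+ 2 - w%:E * 'V_Pr[I])%E.

Definition fixed_truncation (m : R) (x : T) : R :=
  \int[mu]_(s in `[0, m]) gX s x.

Definition tail (Q : law) (s : R) : R := fine (Q `]s, +oo[%classic).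

Definition truncation_law (Q : law) : Prop :=
  Q `[0, +oo[%classic = 1%E /\ (forall s, 0 <= s -> 0 < tail Q s).

(* The truncation level N, with law Q and independent of X, is the second
   coordinate of the product space (T * R, P \x Q). *)
Definition joint (Q : law) : probability (T * measurableTypeR R)%type R :=
  (P \x Q)%E.

Definition randomized_truncation (Q : law) (z : T * measurableTypeR R) : R :=
  \int[mu]_(s in `[0, z.2 : R]) (gX s z.1 / tail Q s).

Definition randomized_sq_integrable (Q : law) : Prop :=
  (\int[joint Q]_z
     (\int[mu]_(s in `[0%R, +oo[)
        (`|gX s z.1| * \1_`]s, +oo[ (z.2 : R) / tail Q s)%R%:E) ^+ 2 < +oo)%E.

Definition admissible (m : R) (Q : law) : Prop :=
  [/\ truncation_law Q, 'E_Q[fun N => N : R]%E = m%:E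
    & randomized_sq_integrable Q].

Definition randomized_variance (Q : law) : \bar R :=
  'V_(joint Q)[randomized_truncation Q]%E.

Definition optimal (m : R) (Q : law) : Prop :=
  admissible m Q /\
  forall Q' : law, admissible m Q' ->
    (randomized_variance Q <= randomized_variance Q')%E.

End truncation.

(* Main.v *)
(* Write G(s) = Q(N > s) and L = \int_0^oo sqrt (Gamma s) ds. Since
   P(N > max s t) / (G s G t) = 1 / G s for s <= t, expanding the square gives
   E[I^2] = 2 \int_0^oo Gamma / G for the randomized estimator I, which is
   unbiased. By AM-GM, \int Gamma / G >= L^2 / m whenever \int G = m, with
   equality for G = (m / L) sqrt Gamma; this is the tail of a law as soon as
   (m / L) sqrt (Gamma 0) <= 1. So for small m an optimal law exists and the
   randomized utility is - w (2 L^2 / m - alpha^2), which tends to -oo as m -> 0,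
   while the utility of the fixed truncation stays bounded below because
   E[(\int_0^oo |g(X_s, s)| ds)^2] is finite. *)
Require Import Defs.
From HB Require Import structures.
From mathcomp Require Import all_boot all_order all_algebra.
From mathcomp Require Import all_classical all_reals all_analysis measurable_realfun.
From mathcomp Require Import ring lra.

Set Implicit Arguments.
Unset Strict Implicit.
Unset Printing Implicit Defensive.

Import Order.TTheory GRing.Theory Num.Theory.
Import numFieldNormedType.Exports.

Local Open Scope classical_set_scope.
Local Open Scope ring_scope.

(** Exchanging expectation and time integrals requires absolute integrability, while a real-valued
    integral silently turns an infinite value into 0. Moments are therefore treated in two rounds:
    absolute values by Tonelli, which decides finiteness, then the signed path by Fubini. The
    randomized estimator obeys the same formulas, being the whole-line integral, on the product
    space, of the path weighted by [1_{N > s} / tail Q s].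

    The weight [1 / sqrt Gamma] in the standing assumption serves twice. For the tail
    [c * sqrt Gamma] the assumption is, up to a constant, the square-integrability required of an
    admissible law; and as [Gamma] decreases, the weight is bounded below, which makes the second
    moment of the absolute path finite. Smoothness of [Gamma] enters as right continuity, so that
    [1 - c * sqrt Gamma] is a distribution function on the half-line; its limit at infinity comes
    from monotonicity and the finiteness of [L]. *)

(** * Scaling, product measures and symmetric double integrals *)

Section integral_scaling.
Local Open Scope ereal_scope.
Context d (T : measurableType d) (R : realType) (m : {measure set T -> \bar R}).

(* Unlike the library's [integralZl], no integrability is needed: the junk
   value [+oo - +oo = -oo] is preserved by a positive factor. *)
Lemma integral_pZl (D : set T) (f : T -> \bar R) (c : R) :
    measurable D -> measurable_fun D f -> (0 < c)%R ->
  \int[m]_(x in D) (c%:E * f x) = c%:E * \int[m]_(x in D) f x.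
Proof.
move=> mD mf c0; rewrite integralE [in RHS]integralE.
rewrite (ge0_funeposM _ (ltW c0)) (ge0_funenegM _ (ltW c0)).
rewrite (ge0_integralZl_EFin _ _ _ (measurable_funepos _)) ?(ltW c0)//.
rewrite (ge0_integralZl_EFin _ _ _ (measurable_funeneg _)) ?(ltW c0)//.
have : 0 <= \int[m]_(x in D) f^\+ x by exact: integral_ge0.
have : 0 <= \int[m]_(x in D) f^\- x by exact: integral_ge0.
have c0' : 0 < c%:E by rewrite lte_fin.
move: (\int[m]_(x in D) f^\+ x) (\int[m]_(x in D) f^\- x) => [a| |] [b| |] // _ _.
- by rewrite -EFinB -!EFinM mulrBr EFinB.
- by rewrite /= (gt0_muley c0') (gt0_muleNy c0').
- by rewrite /= (gt0_muley c0').
- by rewrite /= (gt0_muley c0') (gt0_muleNy c0').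
Qed.

Lemma ge0_or_integrable_restrict (A : set T) (f : T -> \bar R) :
    measurable A -> (forall z, 0 <= f z) \/ m.-integrable setT f ->
  (forall z, 0 <= (f \_ A) z) \/ m.-integrable setT (f \_ A).
Proof.
move=> mA [f0|fi]; first by left=> z; exact: erestrict_ge0.
right; apply: (proj1 (integrable_mkcond f mA)).
exact: integrableS fi.
Qed.

End integral_scaling.

Section product_integral.
Local Open Scope ereal_scope.
Context d1 d2 (T1 : measurableType d1) (T2 : measurableType d2) (R : realType).
Context (m1 : {sigma_finite_measure set T1 -> \bar R}).
Context (m2 : {sigma_finite_measure set T2 -> \bar R}).

(** As [b >= 0], the positive and negative parts of the product are those of [a] times [b], and
    Tonelli applies to each. This is how independence of path and truncation level is used; a
    non-integrable [a] is covered because [c > 0] preserves the default value of an undefined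
    difference. *)
Lemma integral_prod_mule (a : T1 -> R) (b : T2 -> R) (c : R) :
    measurable_fun setT a -> measurable_fun setT b -> (forall y, 0 <= b y)%R ->
    (0 < c)%R -> \int[m2]_y (b y)%:E = c%:E ->
  \int[m1 \x m2]_z (a z.1 * b z.2)%:E = c%:E * \int[m1]_x (a x)%:E.
Proof.
move=> ma mb b0 c0 bc.
have key (u : T1 -> R) : measurable_fun setT u -> (forall x, 0 <= u x)%R ->
    \int[m1 \x m2]_z (u z.1 * b z.2)%:E = c%:E * \int[m1]_x (u x)%:E.
  move=> mu u0; rewrite fubini_tonelli1/=; first last.
  - by move=> z; rewrite lee_fin mulr_ge0.
  - apply/measurable_EFinP; apply: measurable_funM.
      exact: measurableT_comp.
    exact: measurableT_comp.
  rewrite -ge0_integralZl ?lee_fin ?(ltW c0)//; first last.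
  - by move=> x _; rewrite lee_fin.
  - exact/measurable_EFinP.
  apply: eq_integral => x _; rewrite /fubini_F/=.
  under eq_integral do rewrite EFinM.
  rewrite ge0_integralZl ?lee_fin//; first by rewrite bc muleC.
  - exact/measurable_EFinP.
  - by move=> y _; rewrite lee_fin.
have mab : measurable_fun setT (fun z : T1 * T2 => (a z.1 * b z.2)%R).
  by apply: measurable_funM; exact: measurableT_comp.
rewrite -integral_pZl//; last exact/measurable_EFinP.
rewrite [LHS]integralE [RHS]integralE.
have -> : (fun z : T1 * T2 => (a z.1 * b z.2)%:E)^\+ =
          (fun z => (a^\+ z.1 * b z.2)%:E)%R.
  by apply/funext => z; rewrite funeposE/= -EFin_max maxr_pMl// mul0r.
have -> : (fun z : T1 * T2 => (a z.1 * b z.2)%:E)^\- =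
          (fun z => (a^\- z.1 * b z.2)%:E)%R.
  by apply/funext => z; rewrite funenegE/= -EFin_max maxr_pMl// mul0r mulNr.
rewrite (key (a^\+)%R)//; last exact: measurable_funrpos.
rewrite (key (a^\-)%R)//; last exact: measurable_funrneg.
rewrite (ge0_funeposM _ (ltW c0)) (ge0_funenegM _ (ltW c0)).
rewrite (ge0_integralZl_EFin _ _ _ (measurable_funepos _)) ?(ltW c0)//;
  last exact/measurable_EFinP.
rewrite (ge0_integralZl_EFin _ _ _ (measurable_funeneg _)) ?(ltW c0)//;
  last exact/measurable_EFinP.
by congr (_ * _ - _ * _); apply: eq_integral => x _;
  rewrite ?funeposE ?funenegE -?EFinN -EFin_max.
Qed.

(** Keeping both alternatives in one hypothesis lets a single argument serve absolute values, whose
    finiteness is still open, and signed integrands, where it is known. *)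
Lemma fubini_ge0_or_integrable (f : T1 * T2 -> \bar R) :
    measurable_fun setT f ->
    (forall z, 0 <= f z) \/ (m1 \x m2).-integrable setT f ->
  \int[m1 \x m2]_z f z = \int[m1]_x \int[m2]_y f (x, y) /\
  \int[m1 \x m2]_z f z = \int[m2]_y \int[m1]_x f (x, y).
Proof.
move=> mf [f0|fi]; split.
- exact: fubini_tonelli1.
- exact: fubini_tonelli2.
- by rewrite -integral12_prod_meas1.
- by rewrite -integral21_prod_meas1.
Qed.

End product_integral.

Section symmetric_integral.
Local Open Scope ereal_scope.
Context (R : realType).
Local Notation mu := (@lebesgue_measure R).
Local Notation RR := (measurableTypeR R * measurableTypeR R)%type.

(** The diagonal cuts the plane into two halves exchanged by the symmetry. With the first coordinate
    as outer variable on one half and the second on the other, both give the same iterated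
    integral. *)
Lemma integral_symmetric (phi : RR -> \bar R) :
    measurable_fun setT phi -> (forall s t, phi (s, t) = phi (t, s)) ->
    (forall z, 0 <= phi z) \/ (mu \x mu).-integrable setT phi ->
  \int[mu \x mu]_z phi z =
  2%:E * \int[mu]_s \int[mu]_(t in `[s, +oo[) phi (s, t).
Proof.
move=> mphi sym cphi.
pose D : set RR := [set z | (z.1 <= z.2)%R].
have mD : measurable D.
  have : measurable_fun [set: RR] (fun z : RR => (z.1 <= z.2)%R).
    exact: measurable_fun_ler.
  by move=> /(_ measurableT [set true]); rewrite setTI; exact.
have split : \int[mu \x mu]_z phi z =
    \int[mu \x mu]_(z in D) phi z + \int[mu \x mu]_(z in ~` D) phi z.
  rewrite -integral_setU ?setUv//; first exact: measurableC.
  by apply/disj_setPS; rewrite setICr.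
have below : \int[mu \x mu]_(z in D) phi z =
    \int[mu]_s \int[mu]_(t in `[s, +oo[) phi (s, t).
  rewrite integral_mkcond.
  have [-> _] := @fubini_ge0_or_integrable _ _ _ _ _ mu mu (phi \_ D)
    ((measurable_restrictT phi mD).1 (measurable_funTS mphi))
    (ge0_or_integrable_restrict mD cphi).
  apply: eq_integral => s _; rewrite [RHS]integral_mkcond.
  apply: eq_integral => t _; rewrite !patchE.
  by congr (if _ then _ else _); apply/idP/idP;
    rewrite !inE/= in_itv/= andbT.
have above : \int[mu \x mu]_(z in ~` D) phi z =
    \int[mu]_s \int[mu]_(t in `[s, +oo[) phi (s, t).
  rewrite integral_mkcond; have mCD := measurableC mD.
  have [_ ->] := @fubini_ge0_or_integrable _ _ _ _ _ mu mu (phi \_ (~` D))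
    ((measurable_restrictT phi mCD).1 (measurable_funTS mphi))
    (ge0_or_integrable_restrict mCD cphi).
  apply: eq_integral => s _.
  (* The complement of [D] is given by a strict inequality, hence an open ray; its endpoint is a
     null set. *)
  rewrite -[RHS]integral_itv_obnd_cbnd; last first.
    apply: measurable_funTS.
    by apply: (measurableT_comp mphi); exact: pair1_measurable.
  rewrite [RHS]integral_mkcond.
  apply: eq_integral => t _; rewrite !patchE sym.
  congr (if _ then _ else _); apply/idP/idP; rewrite !inE/= in_itv/= andbT.
    by move/negP; rewrite -ltNge.
  by rewrite ltNge => /negP.
by rewrite split below above -[RHS]/(2%:E * _) mule_natl mule2n.
Qed.

End symmetric_integral.

Section parametric_measurability.
Local Open Scope ereal_scope.
Context d1 d2 (T1 : measurableType d1) (T2 : measurableType d2) (R : realType).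
Context (m2 : {sigma_finite_measure set T2 -> \bar R}).

(** The integral is by definition the difference of the integrals of the two parts, each measurable
    in the parameter by Tonelli; parameters with a divergent integral are included. *)
Lemma measurable_parametric_integral (f : T1 * T2 -> \bar R) :
    measurable_fun setT f ->
  measurable_fun setT (fun x => \int[m2]_y f (x, y)).
Proof.
move=> mf.
rewrite (_ : (fun x => _) = fubini_F m2 f^\+ \- fubini_F m2 f^\-); last first.
  apply/funext => x; rewrite [LHS]integralE/=.
  by congr (_ - _); apply: eq_integral => y _; rewrite ?funeposE ?funenegE.
apply: emeasurable_funB; apply: measurable_fun_fubini_tonelli_F => //.
- exact: measurable_funepos.
- exact: measurable_funeneg.
Qed.

End parametric_measurability.

Section tensor_square.
Local Open Scope ereal_scope.
Context d (T : measurableType d) (R : realType).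
Context (m : {sigma_finite_measure set T -> \bar R}).

Lemma integral_tensor_square (f : T -> R) : measurable_fun setT f ->
    (forall x, 0 <= f x)%R \/ m.-integrable setT (EFin \o f) ->
  \int[m \x m]_z (f z.1 * f z.2)%:E = (\int[m]_x (f x)%:E) ^+ 2.
Proof.
move=> mf.
have mff (u : T -> R) : measurable_fun setT u ->
    measurable_fun setT (fun z : T * T => (u z.1 * u z.2)%:E).
  move=> mu; apply/measurable_EFinP.
  by apply: measurable_funM; exact: measurableT_comp.
have ge0case (u : T -> R) : measurable_fun setT u -> (forall x, 0 <= u x)%R ->
    \int[m \x m]_z (u z.1 * u z.2)%:E = (\int[m]_x (u x)%:E) ^+ 2.
  move=> mu u0; rewrite fubini_tonelli1; first last.
  - by move=> z /=; rewrite lee_fin mulr_ge0.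
  - exact: mff.
  rewrite expe2 -ge0_integralZr//; first last.
  - by apply: integral_ge0 => x _; rewrite lee_fin.
  - by move=> x _; rewrite lee_fin.
  - exact/measurable_EFinP.
  apply: eq_integral => x _; rewrite /fubini_F/=.
  under eq_integral do rewrite EFinM.
  rewrite ge0_integralZl ?lee_fin//.
  - exact/measurable_EFinP.
  - by move=> y _; rewrite lee_fin.
case=> [f0|fi]; first exact: ge0case.
(* Integrability on the product comes from the nonnegative case applied to [|f|]. *)
rewrite -integral12_prod_meas1; last first.
  apply/integrableP; split; first exact: mff.
  under eq_integral do rewrite /= normrM.
  rewrite (ge0case (fun x => `|f x|%R))//; last exact: measurableT_comp.
  have /integrableP[_] := fi; rewrite /comp/= => fioo.
  by rewrite lte_mul_pinfty// ?integral_ge0// ge0_fin_numE ?integral_ge0.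
have fin : \int[m]_x (f x)%:E \is a fin_num by exact: integrable_fin_num.
transitivity (\int[m]_x (fine (\int[m]_y (f y)%:E) * f x)%:E).
  apply: eq_integral => x _; rewrite /fubini_F/= EFinM fineK// muleC.
  under eq_integral do rewrite EFinM.
  by rewrite (integralZl measurableT fi).
under eq_integral do rewrite EFinM.
by rewrite (integralZl measurableT fi) fineK.
Qed.

End tensor_square.

(** * First and second moments of integrals along random paths *)

Section Lfun2.
Local Open Scope ereal_scope.
Context d (T : measurableType d) (R : realType) (P : probability T R).

Lemma sqr_integrable_Lfun2 (f : T -> R) : measurable_fun setT f ->
  \int[P]_x (f x ^+ 2)%:E < +oo -> f \in Lfun P 2%:E.
Proof.
move=> mf foo; rewrite inE; apply/andP; split; rewrite inE//=.
rewrite /finite_norm unlock poweR_lty//; apply: le_lt_trans foo.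
rewrite le_eqVlt; apply/orP; left; apply/eqP; apply: eq_integral => x _ /=.

by rewrite powR_mulrn// real_normK ?num_real.
Qed.

End Lfun2.

(* An alias of the product measure: on [m1 \x m2] itself, type inference only
   finds the library's sigma-finite instance for pairs of subprobabilities. *)
Definition sigma_finite_product d1 d2 (T1 : measurableType d1)
    (T2 : measurableType d2) (R : realType)
    (m1 : {sigma_finite_measure set T1 -> \bar R})
    (m2 : {sigma_finite_measure set T2 -> \bar R}) :
  set (T1 * T2) -> \bar R := (m1 \x m2)%E.

Section sigma_finite_product.
Local Open Scope ereal_scope.
Context d1 d2 (T1 : measurableType d1) (T2 : measurableType d2) (R : realType).
Context (m1 : {sigma_finite_measure set T1 -> \bar R}).
Context (m2 : {sigma_finite_measure set T2 -> \bar R}).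

HB.instance Definition _ :=
  Measure.copy (sigma_finite_product m1 m2) (product_measure1 m1 m2).

Let sigma_finiteT_product : sigma_finite setT (sigma_finite_product m1 m2).
Proof.
have /sigma_finiteP[F [TF ndF Foo]] := sigma_finiteT m1.
have /sigma_finiteP[G [TG ndG Goo]] := sigma_finiteT m2.
exists (fun n => F n `*` G n).
  apply/seteqP; split=> // -[x y] _.
  have [i _ Fi] : (\bigcup_i F i) x by rewrite -TF.
  have [j _ Gj] : (\bigcup_j G j) y by rewrite -TG.
  exists (maxn i j) => //; split=> /=.
    by move: Fi; exact/subsetPset/ndF/leq_maxl.
  by move: Gj; exact/subsetPset/ndG/leq_maxr.
move=> k; have [mF Fk] := Foo k; have [mG Gk] := Goo k.
split; first exact: measurableX.
by rewrite /sigma_finite_product product_measure1E// lte_mul_pinfty// ge0_fin_numE.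
Qed.

HB.instance Definition _ := Measure_isSigmaFinite.Build _ _ _
  (sigma_finite_product m1 m2) sigma_finiteT_product.

End sigma_finite_product.

Section ereal_squares.
Local Open Scope ereal_scope.
Context (R : realType).

Lemma fin_num_sqr (a : \bar R) :
  0 <= a -> a * a \is a fin_num -> a \is a fin_num.
Proof. by case: a => [a||] // _; rewrite mulyy. Qed.

(** When [i] is infinite, [fine i] is 0 and [a] is [+oo], so the bound survives a divergent path
    integral. *)
Lemma fine_sqr_le (i a : \bar R) : `|i| <= a -> (fine i ^+ 2)%:E <= a * a.
Proof.
case: a => [a||]; last by case: i.
- case: i => [i||]//; rewrite -EFinM /= !lee_fin => ia.
  rewrite -real_normK ?num_real// expr2. by rewrite ler_pM.
- by move=> _; rewrite mulyy leey.
Qed.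

(** On a probability space this controls a first moment by a second one. *)
Lemma le_1Dsqre (a : \bar R) : 0 <= a -> a <= 1 + a * a.
Proof.
case: a => [a||] // a0; rewrite ?mulyy ?leey//.
by rewrite -EFinM -EFinD lee_fin; nra.
Qed.

End ereal_squares.

Section second_moment.
Local Open Scope ereal_scope.
Context d (T : measurableType d) (R : realType) (P : probability T R).
Local Notation mu := (@lebesgue_measure R).
Local Notation TR := (T * measurableTypeR R)%type.
Variable F : TR -> R.
Hypothesis mF : measurable_fun setT F.

Let RR := (measurableTypeR R * measurableTypeR R)%type.

Let mu2 := sigma_finite_product mu mu.

Let mFx x : measurable_fun setT (fun s : measurableTypeR R => F (x, s)).
Proof. by apply: (measurableT_comp mF); exact: pair1_measurable. Qed.

Let mpair :
  measurable_fun setT (fun z : RR * T => (F (z.2, z.1.1) * F (z.2, z.1.2))%:E).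
Proof.
apply/measurable_EFinP; apply: measurable_funM.
- apply: (measurableT_comp mF); apply: measurable_fun_pair => //.
  exact: measurableT_comp.
- apply: (measurableT_comp mF); apply: measurable_fun_pair => //.
  exact: measurableT_comp.
Qed.

(** Fubini moves the expectation inside the double time integral, and symmetry in [s] and [t] folds
    the plane onto [s <= t]. In the signed case the integrability of the product is the hypothesis
    itself, since [|F (x, s) * F (x, t)|] integrates in time to the square of the integral of
    [|F|]. *)
Let cross_moment :
    (forall z, 0 <= F z)%R \/
    \int[P]_x (\int[mu]_s `|F (x, s)|%:E) ^+ 2 < +oo ->
  \int[P]_x \int[mu \x mu]_z (F (x, z.1) * F (x, z.2))%:E =
  2%:E * \int[mu]_s \int[mu]_(t in `[s, +oo[)
           \int[P]_x (F (x, s) * F (x, t))%:E.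
Proof.
move=> cF.
pose f := fun z : RR * T => (F (z.2, z.1.1) * F (z.2, z.1.2))%:E.
have cf : (forall z, 0 <= f z) \/ (mu2 \x P).-integrable setT f.
  case: cF => [F0|Foo]; [left|right].
    by move=> z; rewrite lee_fin mulr_ge0.
  apply: (proj2 (@integrable21ltyP _ _ _ _ _ mu2 P f mpair)).
  apply: le_lt_trans Foo.
  rewrite le_eqVlt; apply/orP; left; apply/eqP; apply: eq_integral => x _.
  rewrite -(@integral_tensor_square _ _ _ mu (fun s => `|F (x, s)|%R)).
  - by apply: eq_integral => z _ /=; rewrite normrM.
  - exact: measurableT_comp.
  - by left=> s.
have [e1 e2] := @fubini_ge0_or_integrable _ _ _ _ _ mu2 P f mpair cf.
rewrite -[LHS]e2 e1.
rewrite (integral_symmetric (phi := fun z => \int[P]_x f (z, x)))//.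
- exact: (@measurable_parametric_integral _ _ _ _ _ P f).
- by move=> s t; apply: eq_integral => x _; rewrite /f/= mulrC.
- case: cf => [f0|fi]; [left|right].
    by move=> z; exact: integral_ge0.
  exact: (@integrable_fubini_F _ _ _ _ _ mu2 P f fi).
Qed.

(** Both sides may be [+oo]: applied to an absolute value, this decides finiteness before the signed
    formula is used. *)
Lemma ge0_second_moment : (forall z, 0 <= F z)%R ->
  \int[P]_x (\int[mu]_s (F (x, s))%:E) ^+ 2 =
  2%:E * \int[mu]_s \int[mu]_(t in `[s, +oo[)
           \int[P]_x (F (x, s) * F (x, t))%:E.
Proof.
move=> F0; rewrite -cross_moment; last by left.
apply: eq_integral => x _.
by rewrite -(@integral_tensor_square _ _ _ mu (fun s => F (x, s)))//; left.
Qed.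

Hypothesis Foo : \int[P]_x (\int[mu]_s `|F (x, s)|%:E) ^+ 2 < +oo.

Let A x := \int[mu]_s `|F (x, s)|%:E.
Let I x := \int[mu]_s (F (x, s))%:E.

Let mA : measurable_fun setT A.
Proof.
apply: (measurable_parametric_integral mu (f := fun z => `|F z|%:E)).
by apply/measurable_EFinP; exact: measurableT_comp.
Qed.

Let mI : measurable_fun setT I.
Proof.
apply: (measurable_parametric_integral mu (f := fun z => (F z)%:E)).
exact/measurable_EFinP.
Qed.

Let A0 x : 0 <= A x.
Proof. by apply: integral_ge0 => s _; rewrite lee_fin. Qed.

Let IA x : `|I x| <= A x.
Proof. by apply: le_abse_integral => //; exact/measurable_EFinP. Qed.

Lemma ae_integrable_path :
  {ae P, forall x, mu.-integrable setT (fun s => (F (x, s))%:E)}.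
Proof.
have iA2 : P.-integrable setT (fun x => A x * A x).
  apply/integrableP; split; first exact: emeasurable_funM.
  by under eq_integral do rewrite gee0_abs ?mule_ge0//.
have := integrable_ae measurableT iA2; apply: filterS => x /(_ Logic.I) A2fin.
apply/integrableP; split; first exact/measurable_EFinP.
rewrite -ge0_fin_numE; last exact: A0.
move: A2fin; rewrite -/(A x); have := A0 x.
exact: fin_num_sqr.
Qed.

Lemma measurable_fine_path_integral :
  measurable_fun setT (fun x => \int[mu]_s F (x, s))%R.
Proof. exact: measurableT_comp. Qed.

Lemma fine_path_integral_Lfun2 : (fun x => \int[mu]_s F (x, s))%R \in Lfun P 2%:E.
Proof.
apply: sqr_integrable_Lfun2; first exact: measurable_fine_path_integral.
apply: le_lt_trans Foo; apply: ge0_le_integral => //.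
- by move=> x _; rewrite lee_fin sqr_ge0.
- apply/measurable_EFinP; apply: measurable_funX.
  exact: measurable_fine_path_integral.
- exact: emeasurable_funM.
- by move=> x _; exact: fine_sqr_le (IA x).
Qed.

(** Expanding the square takes an integrable path, and almost every path is one; on the exceptional
    null set the real-valued integral is only a default value. *)
Lemma second_moment :
  \int[P]_x ((\int[mu]_s F (x, s)) ^+ 2)%R%:E =
  2%:E * \int[mu]_s \int[mu]_(t in `[s, +oo[)
           \int[P]_x (F (x, s) * F (x, t))%:E.
Proof.
rewrite -cross_moment; last by right.
apply: ae_eq_integral => //.
- apply/measurable_EFinP; apply: measurable_funX.
  exact: measurable_fine_path_integral.
- apply: (@measurable_parametric_integral _ _ _ _ _ mu2
    (fun z : T * RR => (F (z.1, z.2.1) * F (z.1, z.2.2))%:E)).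
  apply/measurable_EFinP; apply: measurable_funM.
  + apply: (measurableT_comp mF); apply: measurable_fun_pair => //.
    exact: measurableT_comp.
  + apply: (measurableT_comp mF); apply: measurable_fun_pair => //.
    exact: measurableT_comp.
apply: filterS ae_integrable_path => x Fi _.
rewrite (@integral_tensor_square _ _ _ mu (fun s => F (x, s)))//; last by right.
by rewrite EFin_expe fineK//; exact: integrable_fin_num.
Qed.

(** Fubini for [P] and Lebesgue measure: integrability on the product follows from [A <= 1 + A * A],
    as [P] has finite mass. *)
Lemma first_moment :
  \int[P]_x (\int[mu]_s F (x, s))%R%:E = \int[mu]_s \int[P]_x (F (x, s))%:E.
Proof.
have iF : (P \x mu).-integrable setT (EFin \o F).
  apply/integrable12ltyP; first exact/measurable_EFinP.
  apply: (@le_lt_trans _ _ (\int[P]_x (1 + A x * A x))).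
    apply: ge0_le_integral => //.
    - by move=> x _; exact: integral_ge0.
    - by apply: emeasurable_funD => //; exact: emeasurable_funM.
    - by move=> x _; exact: (le_1Dsqre (A0 x)).
  rewrite ge0_integralD//; last first.
  - exact: emeasurable_funM.
  - by move=> x _; rewrite mule_ge0//; exact: A0.
  rewrite lte_add_pinfty// integral_cst// mul1e.
  by rewrite (le_lt_trans (probability_le1 P measurableT))// ltry.
have iF' : (P \x mu).-integrable setT (fun z => (F z)%:E) by exact: iF.
transitivity (\int[P]_x I x).
  apply: ae_eq_integral => //.
    apply/measurable_EFinP; exact: measurable_fine_path_integral.
  apply: filterS ae_integrable_path => x Fi _.
  by rewrite fineK//; exact: integrable_fin_num.
have mF' : measurable_fun setT (fun z => (F z)%:E) by exact/measurable_EFinP.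
have [e1 e2] := @fubini_ge0_or_integrable _ _ _ _ _ P mu _ mF' (or_intror iF').
by rewrite -[LHS]e1 e2.
Qed.

End second_moment.

(** * Tails of truncation laws, and the law with a prescribed tail *)

Section halfline_measurability.
Context (R : realType) (f : R -> R).
Local Notation halfline := (`[0, +oo[%classic : set R).

(** Precomposition with [max 0] extends [f] to the left of 0 by the constant [f 0], which keeps it
    monotone on the whole line. *)
Lemma nonincreasing_halfline_measurable :
  (forall s t, 0 <= s -> s <= t -> f t <= f s) -> measurable_fun halfline f.
Proof.
move=> f_ni; suff: measurable_fun halfline (fun s => f (Num.max 0 s)).
  apply: eq_measurable_fun.
  by move=> s; rewrite inE/= in_itv/= andbT => s0; rewrite max_r.
apply: nonincreasing_measurable => // s t st; apply: f_ni.
  by rewrite le_max lexx.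
by rewrite ge_max !le_max lexx st orbT.
Qed.

Lemma nondecreasing_halfline_measurable :
  (forall s t, 0 <= s -> s <= t -> f s <= f t) -> measurable_fun halfline f.
Proof.
move=> f_nd; suff: measurable_fun halfline (fun s => f (Num.max 0 s)).
  apply: eq_measurable_fun.
  by move=> s; rewrite inE/= in_itv/= andbT => s0; rewrite max_r.
apply: nondecreasing_measurable => // s t st; apply: f_nd.
  by rewrite le_max lexx.
by rewrite ge_max !le_max lexx st orbT.
Qed.

End halfline_measurability.

Section tail.
Context (R : realType) (Q : probability (measurableTypeR R) R).

Lemma tailE s : Q `]s, +oo[%classic = (tail Q s)%:E.
Proof. by rewrite fineK// fin_num_measure. Qed.

Lemma tail_nonincreasing s t : s <= t -> tail Q t <= tail Q s.
Proof.
move=> st; rewrite -lee_fin -!tailE; apply: le_measure; rewrite ?inE//.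
by move=> x /=; rewrite !in_itv/= !andbT; exact: le_lt_trans st.
Qed.

Lemma measurable_tail : measurable_fun setT (tail Q).
Proof.
by apply: nonincreasing_measurable => // s t st; exact: tail_nonincreasing.
Qed.

Hypothesis Qlaw : truncation_law Q.

(** Positivity at negative times too lets the weight [1 / tail Q s] be used on the whole line. *)
Lemma tail_gt0 s : 0 < tail Q s.
Proof.
have [s0|s0] := leP 0 s; first exact: (Qlaw.2).
by rewrite (lt_le_trans (Qlaw.2 0 _))// tail_nonincreasing// ltW.
Qed.

Lemma measurable_inv_tail : measurable_fun setT (fun s => (tail Q s)^-1).
Proof.
apply: nondecreasing_measurable => // s t st.
by rewrite lef_pV2 ?posrE ?tail_gt0// tail_nonincreasing.
Qed.

Let pos_part : measurableTypeR R -> R := fun x => Num.max 0 x.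

Let measurable_pos_part : measurable_fun setT pos_part.
Proof. exact: measurable_maxr. Qed.

#[local] HB.instance Definition _ :=
  @isMeasurableFun.Build _ _ _ _ pos_part measurable_pos_part.

(** The layer-cake formula, applied to [max 0 N]: this is nonnegative everywhere, equals [N] almost
    surely and has the same tail at every [s >= 0]. *)
Lemma expectation_tail :
  ('E_Q[fun N => N : R] = \int[lebesgue_measure]_(s in `[0%R, +oo[) (tail Q s)%:E)%E.
Proof.
have -> : ('E_Q[fun N => N : R] = 'E_Q[pos_part])%E.
  rewrite unlock; apply: ae_eq_integral => //.
    exact/measurable_EFinP.
  exists (~` `[0, +oo[%classic); split.
  - exact: measurableC.
  - transitivity (1 - Q `[0%R, +oo[%classic)%E; first exact: probability_setC.
    by rewrite Qlaw.1 subee.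
  - move=> x /=; apply: contra_not; rewrite in_itv/= andbT => x0 _.
    by rewrite /pos_part max_r.
rewrite ge0_expectation_ccdf; last by move=> x; rewrite /pos_part le_max lexx.
apply: eq_integral => s; rewrite inE/= in_itv/= andbT => s0.
rewrite /ccdf /distribution /pushforward -tailE; congr (Q _).
apply/seteqP; split=> x /=; rewrite !in_itv/= !andbT /pos_part lt_max.
  by case/orP => //; rewrite ltNge s0.
by move=> ->; rewrite orbT.
Qed.

End tail.

Section law_of_tail.
Context (R : realType) (phi : R -> R).
Hypothesis phi_le1 : phi 0 <= 1.
Hypothesis phi_noninc : forall s t, 0 <= s -> s <= t -> phi t <= phi s.
Hypothesis phi_rc : forall s, 0 <= s -> phi @ at_right s --> phi s.
Hypothesis phi_y : phi @ +oo --> (0 : R).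

(** A distribution function whose jump at 0, of height [1 - phi 0], is an atom: truncation at time 0
    may have positive probability. *)
Let f (s : R) : R := if s < 0 then 0 else 1 - phi s.

Let f_nd : nondecreasing f.
Proof.
move=> s t st; rewrite /f; have [t0|t0] := ltP t 0.
  by rewrite (le_lt_trans st t0).
have [s0|s0] := ltP s 0; last by rewrite lerB// phi_noninc.
by rewrite subr_ge0 (le_trans _ phi_le1)// phi_noninc.
Qed.

Let f_rc : right_continuous f.
Proof.
move=> s; have [s0|s0] := ltP s 0.
  apply: cvg_near_cst; near=> t.
  by rewrite /f s0 ifT//; near: t; exact: nbhs_right_lt.
rewrite {2}/f ltNge s0/=.
apply: (@cvg_trans _ ((fun t => 1 - phi t) @ at_right s)).
  apply: near_eq_cvg; near=> t.
  by rewrite /f ifF//; apply/negbTE; rewrite -leNgt (le_trans s0)//.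
by apply: cvgB; [exact: cvg_cst|exact: phi_rc].
Unshelve. all: by end_near. Qed.

Let f_Ny : f @ -oo --> (0 : R).
Proof.
apply: cvg_near_cst; near=> t.
by rewrite /f ifT//; near: t; exact: nbhs_ninfty_lt.
Unshelve. all: by end_near. Qed.

Let f_y : f @ +oo --> (1 : R).
Proof.
apply: (@cvg_trans _ ((fun t => 1 - phi t) @ +oo)).
  apply: near_eq_cvg; near=> t.
  by rewrite /f ifF//; apply/negbTE; rewrite -leNgt; near: t; exact: nbhs_pinfty_ge.
have := cvgB (cvg_cst (1 : R)) phi_y.
by rewrite subr0; apply.
Unshelve. all: by end_near. Qed.

#[local] HB.instance Definition _ := isCumulative.Build R _ R f f_nd f_rc.
#[local] HB.instance Definition _ := isCumulativeBounded.Build R 0 1 f f_Ny f_y.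

Let lsf := lebesgue_stieltjes_measure f.

Let pos_part : measurableTypeR R -> measurableTypeR R := fun x : R => Num.max 0 x.

Let measurable_pos_part : measurable_fun setT pos_part.
Proof. exact: measurable_maxr. Qed.

#[local] HB.instance Definition _ :=
  @isMeasurableFun.Build _ _ _ _ pos_part measurable_pos_part.

(* Pushing the Lebesgue-Stieltjes measure of [1 - phi] through [max 0] makes it
   visibly carried by the half-line and does not change its tails. *)
Lemma exists_law_of_tail : exists Q : probability (measurableTypeR R) R,
  Q `[0, +oo[%classic = 1%E /\ forall s, 0 <= s -> tail Q s = phi s.
Proof.
exists (distribution lsf pos_part); split.
  rewrite /distribution /pushforward.
  transitivity (lsf setT); last exact: probability_setT.
  congr (lsf _).
  by apply/seteqP; split=> x //= _; rewrite in_itv/= andbT le_max lexx.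
move=> s s0; apply/EFin_inj; rewrite -tailE /distribution /pushforward.
transitivity (lsf (~` `]-oo, s]%classic)).
  congr (lsf _); apply/seteqP; split=> x /=; rewrite !in_itv/= andbT /pos_part lt_max.
    by rewrite ltNge s0/= => sx; apply/negP; rewrite -ltNge.
  by move=> /negP xs; apply/orP; right; rewrite real_ltNge ?num_real.
transitivity (1 - lsf `]-oo, s]%classic)%E; first exact: probability_setC.
have := cdf_lebesgue_stieltjes_id f s.
rewrite /cdf /distribution /pushforward preimage_id /lsf => ->.
have fs : f s = 1 - phi s by rewrite /f ltNge s0.
by rewrite -[X in (1 - X%:E)%E]/(f s) fs -EFinB subKr.
Qed.

End law_of_tail.

(** * Paths weighted by the survival of an independent truncation level *)

Section thinning.
Local Open Scope ereal_scope.
Context d (T : measurableType d) (R : realType) (P : probability T R).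
Context (Q : probability (measurableTypeR R) R).
Hypothesis Qlaw : truncation_law Q.
Local Notation mu := (@lebesgue_measure R).

(** The integrand of the randomized estimator, as a process on the product space: the random
    endpoint [N] becomes an indicator, so the time domain is fixed and the moment formulas apply. *)
Definition thinned (h : T * measurableTypeR R -> R)
    (p : T * measurableTypeR R * measurableTypeR R) : R :=
  (h (p.1.1, p.2) * \1_`]p.2, +oo[ (p.1.2 : R) / tail Q p.2)%R.

Let survives s : measurable_fun setT
  (fun N : measurableTypeR R => \1_`]s, +oo[ (N : R) : R).
Proof. by apply: measurable_indic; exact: measurable_itv. Qed.

Let mean_survives s : \int[Q]_N (\1_`]s, +oo[ (N : R) : R)%:E = (tail Q s)%:E.
Proof. by rewrite integral_indic ?setIT; [exact: tailE| |exact: measurable_itv]. Qed.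

Variable h : T * measurableTypeR R -> R.
Hypothesis mh : measurable_fun setT h.

Lemma measurable_section s : measurable_fun setT (fun x => h (x, s)).
Proof. by apply: (measurableT_comp mh); exact: pair2_measurable. Qed.

Lemma measurable_thinned : measurable_fun setT (thinned h).
Proof.
apply: measurable_funM; first apply: measurable_funM.
- apply: (measurableT_comp mh); apply: measurable_fun_pair => //.
  exact: measurableT_comp.
- rewrite (_ : (fun p => _) = (fun p : T * measurableTypeR R * measurableTypeR R =>
      if (p.2 < p.1.2 :> R)%R then 1 else 0)%R); last first.
    by apply/funext => p; rewrite indicE mem_setE in_itv/= andbT; case: ifP.
  apply: measurable_fun_ifT => //; apply: measurable_fun_ltr => //.
  exact: measurableT_comp.
- by apply: (measurableT_comp (measurable_inv_tail Qlaw)).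
Qed.

Lemma thinned_cross_moment s t : (s <= t)%R ->
  \int[joint P Q]_z (thinned h (z, s) * thinned h (z, t))%:E =
  (tail Q s)^-1%:E * \int[P]_x (h (x, s) * h (x, t))%:E.
Proof.
move=> st; have Qs := tail_gt0 Qlaw s; have Qt := tail_gt0 Qlaw t.
(* All dependence on [N] is collected in one nonnegative factor, of mean [1 / tail Q s]. *)
rewrite -(@integral_prod_mule _ _ _ _ _ P Q (fun x => h (x, s) * h (x, t))%R
  (fun N => \1_`]t, +oo[ (N : R) * (tail Q s * tail Q t)^-1)%R)//.
- apply: eq_integral => -[x N] _; rewrite /thinned/=; congr EFin.
  have e : (\1_`]t, +oo[ (N : R) = \1_`]s, +oo[ N * \1_`]t, +oo[ N :> R)%R.
    rewrite -[RHS]/((\1_`]s, +oo[ \* \1_`]t, +oo[) N)%R -indicI.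
    congr (\1_ _ _); apply/seteqP; split=> y /=; rewrite !in_itv/= !andbT.
      by move=> ty; split=> //; exact: le_lt_trans ty.
    by case.
  by rewrite [in RHS]e invfM; ring.
- by apply: measurable_funM; exact: measurable_section.
- exact: measurable_funM.
- by move=> N; rewrite mulr_ge0// invr_ge0 mulr_ge0// ltW.
- by rewrite invr_gt0.
- under eq_integral do rewrite EFinM.
  rewrite ge0_integralZr//; last 2 first.
  + exact/measurable_EFinP.
  + by rewrite lee_fin invr_ge0 mulr_ge0// ltW.
  rewrite mean_survives -EFinM; congr EFin.
  by field; rewrite !gt_eqF.
Qed.

(** Unbiasedness holds at each time separately: the survival indicator is divided by its own
    mean. *)
Lemma thinned_mean s :
  \int[joint P Q]_z (thinned h (z, s))%:E = \int[P]_x (h (x, s))%:E.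
Proof.
have Qs := tail_gt0 Qlaw s.
rewrite -[RHS]mul1e.
rewrite -(@integral_prod_mule _ _ _ _ _ P Q (fun x => h (x, s))
  (fun N => \1_`]s, +oo[ (N : R) * (tail Q s)^-1)%R)//.
- by apply: eq_integral => -[x N] _; rewrite /thinned/= mulrA.
- exact: measurable_section.
- exact: measurable_funM.
- by move=> N; rewrite mulr_ge0// invr_ge0 ltW.
- under eq_integral do rewrite EFinM.
  rewrite ge0_integralZr//; last 2 first.
  + exact/measurable_EFinP.
  + by rewrite lee_fin invr_ge0 ltW.
  by rewrite mean_survives -EFinM divff// gt_eqF.
Qed.

Lemma thinned_double_integral :
  \int[mu]_s \int[mu]_(t in `[s, +oo[)
     \int[joint P Q]_z (thinned h (z, s) * thinned h (z, t))%:E =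
  \int[mu]_s ((tail Q s)^-1%:E *
     \int[mu]_(t in `[s, +oo[) \int[P]_x (h (x, s) * h (x, t))%:E).
Proof.
apply: eq_integral => s _; rewrite -integral_pZl//; last 2 first.
- apply: measurable_funTS.
  apply: (@measurable_parametric_integral _ _ _ _ _ P
    (fun z : measurableTypeR R * T => (h (z.2, s) * h (z.2, z.1))%:E)).
  apply/measurable_EFinP; apply: measurable_funM.
    by apply: (measurableT_comp (measurable_section s)).
  by apply: (measurableT_comp mh); exact: measurable_swap.
- by rewrite invr_gt0 tail_gt0.
apply: eq_integral => t; rewrite inE/= in_itv/= andbT => st.
exact: thinned_cross_moment.
Qed.

End thinning.

(** The weight is nonnegative. Hence the nonnegative moment formula for [|h|] governs the absolute
    integrability of the thinned path. *)
Lemma normr_thinned d (T : measurableType d) (R : realType)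
    (Q : probability (measurableTypeR R) R) (h : T * measurableTypeR R -> R) p :
  truncation_law Q ->
  `|thinned Q h p| = thinned Q (fun z => `|h z|) p.
Proof.
move=> Qlaw; have G0 := tail_gt0 Qlaw p.2.
by rewrite /thinned !normrM normfV (gtr0_norm G0) [`|\1_ _ _|]ger0_norm.
Qed.

(** * Paths of the process and their upper moments *)

Section paths.
Local Open Scope ereal_scope.
Context (R : realType) d (T : measurableType d) (P : probability T R).
Context (S : Type) (X : R -> T -> S) (g : S -> R -> R).
Local Notation mu := (@lebesgue_measure R).

(* Extending by [0] to negative times lets the moment lemmas, which integrate
   over the whole line, apply. *)
Definition ext_path (z : T * measurableTypeR R) : R :=
  if (0 <= z.2 :> R)%R then gX X g z.2 z.1 else 0%R.

Lemma ext_pathE x s : (0 <= s)%R -> ext_path (x, s) = gX X g s x.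
Proof. by rewrite /ext_path /= => ->. Qed.

Lemma ext_path_lt0 x s : (s < 0)%R -> ext_path (x, s) = 0%R.
Proof. by rewrite /ext_path /= leNgt => ->. Qed.

Lemma measurable_ext_path : jointly_measurable X g ->
  measurable_fun setT ext_path.
Proof.
move=> mg.
pose D : set (measurableTypeR R * T) := (`[0, +oo[%classic `*` setT)%R.
have mD : measurable D by apply: measurableX.
have -> : ext_path = ((fun z : measurableTypeR R * T => gX X g z.1 z.2) \_ D)
    \o (fun z : T * measurableTypeR R => (z.2, z.1)).
  apply/funext => -[x s]; rewrite /= patchE /ext_path/=.
  congr (if _ then _ else _); apply/idP/idP; rewrite inE /D /= in_itv/= andbT.
    by [].
  by case.
apply: measurableT_comp; last exact: measurable_swap.
exact: ((measurable_restrictT _ mD).1 mg).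
Qed.

(** At [ext_path] and [s >= 0] this is [Gamma s]; at the absolute value of [ext_path] it is the
    inner integral of the standing assumption. *)
Definition upper_moment (h : T * measurableTypeR R -> R) (s : R) : \bar R :=
  \int[mu]_(t in `[s, +oo[) \int[P]_x (h (x, s) * h (x, t))%:E.

(** The ray of integration moves with [s]; restricting a function of the plane to [s <= t] turns
    this into a parametric integral over a fixed domain. *)
Lemma measurable_upper_moment h : measurable_fun setT h ->
  measurable_fun setT (upper_moment h : measurableTypeR R -> \bar R).
Proof.
move=> mh.
pose RR := (measurableTypeR R * measurableTypeR R)%type.
pose D : set RR := [set z | (z.1 <= z.2)%R].
have mD : measurable D.
  have : measurable_fun [set: RR] (fun z : RR => (z.1 <= z.2)%R).
    exact: measurable_fun_ler.
  by move=> /(_ measurableT [set true]); rewrite setTI; exact.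
pose phi (z : RR) := \int[P]_x (h (x, z.1) * h (x, z.2))%:E.
have mphi : measurable_fun setT phi.
  apply: (@measurable_parametric_integral _ _ _ _ _ P
    (fun z : RR * T => (h (z.2, z.1.1) * h (z.2, z.1.2))%:E)).
  apply/measurable_EFinP; apply: measurable_funM.
  - apply: (measurableT_comp mh); apply: measurable_fun_pair => //.
    exact: measurableT_comp.
  - apply: (measurableT_comp mh); apply: measurable_fun_pair => //.
    exact: measurableT_comp.
have -> : upper_moment h = fun s => \int[mu]_t (phi \_ D) (s, t).
  apply/funext => s; rewrite /upper_moment integral_mkcond.
  apply: eq_integral => t _; rewrite !patchE.
  by congr (if _ then _ else _); apply/idP/idP; rewrite !inE/= in_itv/= andbT.
apply: (@measurable_parametric_integral _ _ _ _ _ mu (phi \_ D)).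
exact: ((measurable_restrictT phi mD).1 (measurable_funTS mphi)).
Qed.

Lemma upper_moment_ge0 h s : (forall z, 0 <= h z)%R -> 0 <= upper_moment h s.
Proof.
move=> h0; apply: integral_ge0 => t _; apply: integral_ge0 => x _.
by rewrite lee_fin mulr_ge0.
Qed.

Lemma abse_upper_moment_le h s : measurable_fun setT h ->
  `|upper_moment h s| <= upper_moment (fun z => `|h z|%R) s.
Proof.
move=> mh.
have msec t := measurable_section mh t.
have mprod t : measurable_fun setT (fun x => (h (x, s) * h (x, t))%:E).
  by apply/measurable_EFinP; exact: measurable_funM.
have mint (u : T * measurableTypeR R -> R) : measurable_fun setT u ->
    measurable_fun setT (fun t : measurableTypeR R =>
      \int[P]_x (u (x, s) * u (x, t))%:E).
  move=> mu_; apply: (@measurable_parametric_integral _ _ _ _ _ P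
    (fun z : measurableTypeR R * T => (u (z.2, s) * u (z.2, z.1))%:E)).
  apply/measurable_EFinP; apply: measurable_funM.
    by apply: (measurableT_comp (measurable_section mu_ s)).
  by apply: (measurableT_comp mu_); exact: measurable_swap.
apply: (le_trans (le_abse_integral _ _ _)) => //.
  by apply: measurable_funTS; exact: (mint h).
apply: ge0_le_integral => //.
- by apply: measurableT_comp => //; exact: measurable_funTS (mint h mh).
- have mh' : measurable_fun setT (fun z => `|h z|%R) by exact: measurableT_comp.
  exact: measurable_funTS (mint _ mh').
- move=> t _; apply: (le_trans (le_abse_integral _ _ (mprod t))) => //.
  by under eq_integral do rewrite /= normrM.
Qed.

Lemma upper_moment_ext_path s : (0 <= s)%R ->
  upper_moment ext_path s = \int[mu]_(t in `[s, +oo[) Gamma_integrand P X g s t.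
Proof.
move=> s0; apply: eq_integral => t; rewrite inE/= in_itv/= andbT => st.
rewrite /Gamma_integrand unlock; apply: eq_integral => x _.
by rewrite !ext_pathE ?(le_trans s0)// mulrC.
Qed.

Lemma upper_moment_norm_ext_path s : (0 <= s)%R ->
  upper_moment (fun z => `|ext_path z|%R) s =
  \int[mu]_(t in `[s, +oo[) \int[P]_x (`|gX X g s x * gX X g t x|%R)%:E.
Proof.
move=> s0; apply: eq_integral => t; rewrite inE/= in_itv/= andbT => st.
by apply: eq_integral => x _; rewrite normrM !ext_pathE ?(le_trans s0).
Qed.

Lemma upper_moment_lt0 h s : (forall x, h (x, s) = 0%R) -> upper_moment h s = 0.
Proof.
by move=> h0; apply: integral0_eq => t _; apply: integral0_eq => x _; rewrite h0 mul0r.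
Qed.

End paths.

(** * Finiteness, mean and variance of the estimators *)

Section truncation_moments.
Local Open Scope ereal_scope.
Context (R : realType) d (T : measurableType d) (P : probability T R).
Context (S : Type) (X : R -> T -> S) (g : S -> R -> R).
Hypothesis Hg : jointly_measurable X g.
Hypothesis Hint : standing_integrability P X g.
Hypothesis Hnonneg : forall s : R, (0 <= s)%R -> (0 <= Gamma P X g s)%R.
Hypothesis Hdecr : forall s t : R, (0 <= s)%R -> (s < t)%R ->
  (Gamma P X g t < Gamma P X g s)%R.

Local Notation mu := (@lebesgue_measure R).
Local Notation Gam := (Gamma P X g).
Local Notation halfline := (`[0, +oo[%classic : set R)%R.
Local Notation h := (ext_path X g).
Local Notation absh := (fun z => `|h z|%R).

Let mh : measurable_fun setT h. Proof. exact: measurable_ext_path. Qed.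
Let mabsh : measurable_fun setT absh. Proof. exact: measurableT_comp. Qed.

(** A zero at [s] would force a negative value at [s + 1]. *)
Lemma Gamma_gt0 s : (0 <= s)%R -> (0 < Gam s)%R.
Proof.
move=> s0; have s1 : (s < s + 1)%R by rewrite ltrDl.
by apply: le_lt_trans (Hdecr s0 s1); rewrite Hnonneg// addr_ge0.
Qed.

Lemma Gamma_nonincreasing s t : (0 <= s)%R -> (s <= t)%R -> (Gam t <= Gam s)%R.
Proof.
by move=> s0; rewrite le_eqVlt => /predU1P[->//|/(Hdecr s0)/ltW].
Qed.

Lemma upper_moment_Gamma s : (0 <= s)%R -> upper_moment P h s = (Gam s)%:E.
Proof.
move=> s0; rewrite upper_moment_ext_path// /Gamma fineK//.
exact: integrable_fin_num (Hint.1 _ s0).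
Qed.

Let mabsm :
  measurable_fun setT (upper_moment P absh : measurableTypeR R -> \bar R).
Proof. exact: measurable_upper_moment. Qed.

Let absm_ge0 s : 0 <= upper_moment P absh s.
Proof. exact: upper_moment_ge0. Qed.

Let absm_lt0 s : (s < 0)%R -> upper_moment P absh s = 0.
Proof.
by move=> s0; apply: upper_moment_lt0 => x; rewrite ext_path_lt0// normr0.
Qed.

Lemma weighted_absm_lty :
  \int[mu]_(s in `[0%R, +oo[)
    ((Num.sqrt (Gam s))^-1%:E * upper_moment P absh s) < +oo.
Proof.
apply: le_lt_trans Hint.2; rewrite le_eqVlt; apply/orP; left; apply/eqP.
apply: eq_integral => s; rewrite inE/= in_itv/= andbT => s0.
by rewrite upper_moment_norm_ext_path.
Qed.

Lemma sqrt_Gamma_gt0 s : (0 <= s)%R -> (0 < Num.sqrt (Gam s))%R.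
Proof. by move=> s0; rewrite sqrtr_gt0 Gamma_gt0. Qed.

Lemma sqrt_Gamma_nonincreasing s t : (0 <= s)%R -> (s <= t)%R ->
  (Num.sqrt (Gam t) <= Num.sqrt (Gam s))%R.
Proof. by move=> s0 st; rewrite ler_wsqrtr// Gamma_nonincreasing. Qed.

Let measurable_Gamma : measurable_fun halfline Gam.
Proof. apply: nonincreasing_halfline_measurable; exact: Gamma_nonincreasing. Qed.

Let measurable_sqrt_Gamma :
  measurable_fun halfline (fun s => Num.sqrt (Gam s)).
Proof. apply: nonincreasing_halfline_measurable; exact: sqrt_Gamma_nonincreasing. Qed.

Let measurable_weighted_absm : measurable_fun halfline
  (fun s => (Num.sqrt (Gam s))^-1%:E * upper_moment P absh s).
Proof.
apply: emeasurable_funM; last exact: measurable_funTS mabsm.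
apply/measurable_EFinP; apply: nondecreasing_halfline_measurable => s t s0 st.
by rewrite lef_pV2 ?posrE ?sqrt_Gamma_gt0 ?(le_trans s0)// sqrt_Gamma_nonincreasing.
Qed.

(** Writing [sqrt Gamma] as [Gamma / sqrt Gamma] and bounding [Gamma] by the absolute upper moment
    places it under the standing assumption; this makes [L] finite. *)
Lemma sqrt_Gamma_le s : (0 <= s)%R ->
  (Num.sqrt (Gam s))%:E <= (Num.sqrt (Gam s))^-1%:E * upper_moment P absh s.
Proof.
move=> s0; have G0 := Gamma_gt0 s0; have r0 := sqrt_Gamma_gt0 s0.
have -> : (Num.sqrt (Gam s))%:E = (Num.sqrt (Gam s))^-1%:E * (Gam s)%:E.
  rewrite -EFinM; congr EFin; rewrite -{3}(sqr_sqrtr (ltW G0)).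
  by field; rewrite gt_eqF.
apply: lee_wpmul2l; first by rewrite lee_fin invr_ge0 ltW.
rewrite -upper_moment_Gamma//; apply: le_trans (lee_abs _) _.
exact: abse_upper_moment_le.
Qed.

Definition sqrt_Gamma_mass : R := (\int[mu]_(s in `[0, +oo[) Num.sqrt (Gam s))%R.
Local Notation L := sqrt_Gamma_mass.

Lemma integral_sqrt_Gamma :
  \int[mu]_(s in `[0%R, +oo[) (Num.sqrt (Gam s))%:E = L%:E.
Proof.
rewrite /sqrt_Gamma_mass /Rintegral fineK// ge0_fin_numE; last first.
  by apply: integral_ge0 => s _; rewrite lee_fin.
apply: le_lt_trans weighted_absm_lty; apply: ge0_le_integral => //.
- exact/measurable_EFinP.
- by move=> s /=; rewrite in_itv/= andbT; exact: sqrt_Gamma_le.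
Qed.

Lemma sqrt_Gamma_mass_gt0 : (0 < L)%R.
Proof.
rewrite -lte_fin -integral_sqrt_Gamma.
apply: (@lt_le_trans _ _ (\int[mu]_(s in `[0%R, 1%R]) (Num.sqrt (Gam 1))%:E)).
  rewrite integral_cst//= lebesgue_measure_itv/= lte_fin ltr01 oppr0 adde0 mule1.
  by rewrite lte_fin sqrt_Gamma_gt0.
apply: (@le_trans _ _ (\int[mu]_(s in `[0%R, 1%R]) (Num.sqrt (Gam s))%:E)).
  apply: ge0_le_integral => //.
  - by apply/measurable_EFinP; apply: measurable_funS measurable_sqrt_Gamma => //;
      exact: subset_itvl.
  - move=> s /=; rewrite in_itv/= => /andP[s0 s1].
    by rewrite lee_fin sqrt_Gamma_nonincreasing.
apply: ge0_subset_integral => //.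
- exact/measurable_EFinP.
- exact: subset_itvl.
Qed.

Definition abs_path_moment : \bar R := \int[P]_x (\int[mu]_s `|h (x, s)|%:E) ^+ 2.

(** By monotonicity [sqrt (Gamma 0) / sqrt (Gamma s) >= 1], so the unweighted integral of the
    absolute upper moment is at most [sqrt (Gamma 0)] times the weighted one, finite by
    assumption. *)
Lemma abs_path_moment_lty : abs_path_moment < +oo.
Proof.
rewrite /abs_path_moment (ge0_second_moment P mabsh)//.
rewrite lte_mul_pinfty//.
rewrite -/(upper_moment P absh).
apply: (@le_lt_trans _ _ ((Num.sqrt (Gam 0))%:E *
  \int[mu]_(s in `[0%R, +oo[)
    ((Num.sqrt (Gam s))^-1%:E * upper_moment P absh s))); last first.
  by rewrite lte_mul_pinfty// ?weighted_absm_lty// lee_fin.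
rewrite -ge0_integralZl//; last first.
  move=> s /=; rewrite in_itv/= andbT => s0.
  by rewrite mule_ge0// lee_fin invr_ge0 ltW// sqrt_Gamma_gt0.
rewrite [leRHS]integral_mkcond; apply: ge0_le_integral => //.
- by move=> s _; exact: absm_ge0.
- have mw := measurable_funeM (Num.sqrt (Gam 0))%:E measurable_weighted_absm.
  exact: ((measurable_restrictT _ (measurable_itv _)).1 mw).
- move=> s _; rewrite patchE mem_setE in_itv/= andbT; case: (leP 0%R s) => s0.
    rewrite muleA -EFinM -[leLHS]mul1e; apply: lee_wpmul2r; first exact: absm_ge0.
    by rewrite lee_fin ler_pdivlMr ?sqrt_Gamma_gt0// mul1r sqrt_Gamma_nonincreasing.
  by rewrite -/(upper_moment P absh s) absm_lt0.
Qed.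

Let joint_abs_moment Q : truncation_law Q ->
  \int[joint P Q]_z (\int[mu]_s `|thinned Q h (z, s)|%:E) ^+ 2 =
  2%:E * \int[mu]_(s in `[0%R, +oo[)
     ((tail Q s)^-1%:E * upper_moment P absh s).
Proof.
move=> Qlaw.
under eq_integral => z _.
  under eq_integral => s _ do rewrite normr_thinned//.
  over.
rewrite ge0_second_moment//; last 2 first.
- exact: measurable_thinned.
- by move=> p; rewrite -normr_thinned.
rewrite thinned_double_integral//; congr (_ * _).
rewrite [RHS]integral_mkcond; apply: eq_integral => s _; rewrite patchE.
rewrite mem_setE in_itv/= andbT; case: (leP 0%R s) => // s0.
by rewrite -/(upper_moment P absh s) absm_lt0// mule0.
Qed.

Let abs_thinnedE Q z : truncation_law Q ->
  \int[mu]_s `|thinned Q h (z, s)|%:E =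
  \int[mu]_(s in `[0%R, +oo[)
    (`|gX X g s z.1| * \1_`]s, +oo[ (z.2 : R) / tail Q s)%R%:E.
Proof.
move=> Qlaw; rewrite [RHS]integral_mkcond; apply: eq_integral => s _.
rewrite normr_thinned// patchE mem_setE in_itv/= andbT /thinned/=.
case: (leP 0%R s) => s0; first by rewrite ext_pathE.
by rewrite ext_path_lt0// normr0 !mul0r.
Qed.

(** Reduces a condition on the product space to a one-dimensional integral with weight [1 / tail Q],
    directly comparable with the standing assumption. *)
Lemma randomized_sq_integrableE Q : truncation_law Q ->
  randomized_sq_integrable P X g Q <->
  \int[mu]_(s in `[0%R, +oo[)
     ((tail Q s)^-1%:E * upper_moment P absh s) < +oo.
Proof.
move=> Qlaw; rewrite /randomized_sq_integrable.
under eq_integral do rewrite -abs_thinnedE//.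
rewrite joint_abs_moment//; split; last by move=> ?; rewrite lte_mul_pinfty.
apply: contraTT; rewrite -!leNgt !leye_eq => /eqP ->.
by rewrite gt0_muley ?lte_fin.
Qed.

Lemma randomized_truncationE Q z : truncation_law Q ->
  randomized_truncation X g Q z = (\int[mu]_s thinned Q h (z, s))%R.
Proof.
move=> Qlaw; rewrite /randomized_truncation /Rintegral; congr fine.
have [N0|N0] := ltP (z.2 : R) 0%R.
  rewrite set_itv_ge ?bnd_simp -?ltNge// integral_set0.
  apply/esym/integral0_eq => s _; rewrite /thinned indicE mem_setE in_itv/= andbT.
  have [s0|s0] := leP 0%R s; last by rewrite ext_path_lt0// !mul0r.
  by rewrite ltNge (ltW (lt_le_trans N0 s0)) mulr0 mul0r.
(* Survival is strict, [s < N], so the endpoint [N] is dropped from the closed interval. *)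
rewrite -integral_itv_bndo_bndc; last first.
  apply: (@eq_measurable_fun _ _ _ _ _
    (fun s : measurableTypeR R => (h (z.1, s) * (tail Q s)^-1)%:E)).
    by move=> s; rewrite inE/= in_itv/= => /andP[s0 _]; rewrite ext_pathE.
  apply/measurable_EFinP; apply: measurable_funTS; apply: measurable_funM.
    by apply: (measurableT_comp mh); exact: pair1_measurable.
  exact: measurable_inv_tail.
rewrite [LHS]integral_mkcond; apply: eq_integral => s _.
rewrite patchE mem_setE in_itv/= /thinned indicE mem_setE in_itv/= andbT.
have [s0|s0] := leP 0%R s; last by rewrite ext_path_lt0// !mul0r.
by rewrite ext_pathE//=; case: ifP => _; rewrite ?mulr1// mulr0 mul0r.
Qed.

Let joint_abs_moment_lty Q : truncation_law Q -> randomized_sq_integrable P X g Q ->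
  \int[joint P Q]_z (\int[mu]_s `|thinned Q h (z, s)|%:E) ^+ 2 < +oo.
Proof.
move=> Qlaw; rewrite /randomized_sq_integrable.
by under eq_integral do rewrite -abs_thinnedE//.
Qed.

Lemma alphaE : alpha P X g = \int[mu]_s \int[P]_x (h (x, s))%:E.
Proof.
rewrite -(first_moment mh abs_path_moment_lty) /alpha unlock.
apply: eq_integral => x _; rewrite Rintegral_mkcond; congr EFin.
apply: eq_Rintegral => s _; rewrite patchE mem_setE in_itv/= andbT.
by case: (leP 0%R s) => s0; [rewrite ext_pathE|rewrite ext_path_lt0].
Qed.

Lemma alpha_fin_num : alpha P X g \is a fin_num.
Proof.
rewrite alphaE -(first_moment mh abs_path_moment_lty).
have L2 := fine_path_integral_Lfun2 mh abs_path_moment_lty.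
have L1 := Lfun_subset12 (fin_num_measure P setT measurableT) L2.
by have := expectation_fin_num L1; rewrite unlock.
Qed.

Lemma randomized_mean Q : truncation_law Q -> randomized_sq_integrable P X g Q ->
  'E_(joint P Q)[randomized_truncation X g Q] = alpha P X g.
Proof.
move=> Qlaw Qint; rewrite unlock.
under eq_integral do rewrite randomized_truncationE//.
rewrite (first_moment (measurable_thinned Qlaw mh) (joint_abs_moment_lty Qlaw Qint)).
by rewrite alphaE; apply: eq_integral => s _; exact: thinned_mean.
Qed.

(** The witness [V] records that the integral of [Gamma / tail Q] is finite, which is read off from
    the finite second moment of the estimator. *)
Lemma randomized_varianceE Q :
    truncation_law Q -> randomized_sq_integrable P X g Q ->
  exists2 V : R, \int[mu]_(s in `[0%R, +oo[) (Gam s / tail Q s)%:E = V%:E &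
    randomized_variance P X g Q = (2 * V - fine (alpha P X g) ^+ 2)%:E.
Proof.
move=> Qlaw Qint; have mth := measurable_thinned Qlaw mh.
have fin := joint_abs_moment_lty Qlaw Qint.
have rtE : randomized_truncation X g Q =
    (fun z => \int[mu]_s thinned Q h (z, s))%R.
  by apply/funext => z; rewrite randomized_truncationE.
have L2 := fine_path_integral_Lfun2 mth fin; rewrite -rtE in L2.
have m2 : 'E_(joint P Q)[randomized_truncation X g Q ^+ 2] =
    2%:E * \int[mu]_(s in `[0%R, +oo[) (Gam s / tail Q s)%:E.
  rewrite unlock rtE.
  transitivity (\int[joint P Q]_z ((\int[mu]_s thinned Q h (z, s)) ^+ 2)%R%:E).
    by apply: eq_integral => z _; rewrite fctE.
  rewrite (second_moment mth fin) thinned_double_integral//; congr (_ * _).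
  rewrite [RHS]integral_mkcond; apply: eq_integral => s _; rewrite patchE.
  rewrite mem_setE in_itv/= andbT; case: (leP 0%R s) => s0.
    by rewrite -/(upper_moment P h s) upper_moment_Gamma// -EFinM mulrC.
  rewrite -/(upper_moment P h s) upper_moment_lt0 ?mule0// => x.
  by rewrite ext_path_lt0.
have m2fin : 'E_(joint P Q)[randomized_truncation X g Q ^+ 2] \is a fin_num.
  exact: expectation_fin_num (Lfun2_mul_Lfun1 L2 L2).
have V0 : 0 <= \int[mu]_(s in `[0%R, +oo[) (Gam s / tail Q s)%:E.
  apply: integral_ge0 => s /=; rewrite in_itv/= andbT => s0.
  by rewrite lee_fin divr_ge0 ?Hnonneg// ltW// tail_gt0.
have Vfin : \int[mu]_(s in `[0%R, +oo[) (Gam s / tail Q s)%:E \is a fin_num.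
  move: m2fin; rewrite m2 => m2fin.
  move: V0 m2fin; case: (\int[mu]_(s in _) _) => //= _.
  by rewrite gt0_muley ?lte_fin.
exists (fine (\int[mu]_(s in `[0%R, +oo[) (Gam s / tail Q s)%:E)).
  by rewrite fineK.
rewrite /randomized_variance varianceE// randomized_mean// m2.
by rewrite -[in LHS](fineK Vfin) -[in LHS](fineK alpha_fin_num) -EFin_expe.
Qed.

(** * Minimising the variance over truncation laws *)

(** The pointwise bound [Gamma / G >= 2 sqrt Gamma / c - G / c^2] involves only functions of known
    integral, [L] and [m]. The choice [c = m / L] maximises the resulting value
    [2 L / c - m / c^2]. *)
Lemma weighted_mean_ge Q (m : R) : truncation_law Q -> (0 < m)%R ->
    'E_Q[fun N => N : R] = m%:E ->
  (L ^+ 2 / m)%:E <= \int[mu]_(s in `[0%R, +oo[) (Gam s / tail Q s)%:E.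
Proof.
move=> Qlaw m0 QN; have L0 := sqrt_Gamma_mass_gt0.
pose c := (m / L)%R; have c0 : (0 < c)%R by rewrite divr_gt0.
have mtail : measurable_fun halfline (tail Q).
  exact: measurable_funTS (measurable_tail Q).
have mratio : measurable_fun halfline (fun s => (Gam s / tail Q s)%R).
  by apply: measurable_funM => //; exact: measurable_funTS (measurable_inv_tail Qlaw).
have mean : \int[mu]_(s in `[0%R, +oo[) (c ^- 2 * tail Q s)%:E = (m / c ^+ 2)%:E.
  under eq_integral do rewrite EFinM.
  rewrite ge0_integralZl//.
  - by rewrite -expectation_tail// QN -EFinM mulrC.
  - exact/measurable_EFinP.
  - by move=> s _; rewrite lee_fin ltW// tail_gt0.
  - by rewrite lee_fin invr_ge0 sqr_ge0.
have mass : \int[mu]_(s in `[0%R, +oo[) (2 / c * Num.sqrt (Gam s))%:E =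
    (2 / c * L)%:E.
  under eq_integral do rewrite EFinM.
  rewrite ge0_integralZl//.
  - by rewrite integral_sqrt_Gamma.
  - exact/measurable_EFinP.
  - by rewrite lee_fin divr_ge0// ltW.
have -> : (L ^+ 2 / m = 2 / c * L - m / c ^+ 2)%R.
  by rewrite /c; field; rewrite !gt_eqF.
(* The subtracted term is moved across, so only nonnegative integrands are added; the left integral
   may still be infinite. *)
rewrite EFinB leeBlDr// -mass -mean -ge0_integralD//.
- apply: ge0_le_integral => //.
  + move=> s /=; rewrite in_itv/= andbT => s0.
    by rewrite lee_fin mulr_ge0// divr_ge0// ltW.
  + by apply/measurable_EFinP; exact: measurable_funM.
  + by apply: emeasurable_funD; apply/measurable_EFinP => //; exact: measurable_funM.
  + move=> s /=; rewrite in_itv/= andbT => s0.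
    have G0 := tail_gt0 Qlaw s; rewrite -EFinD lee_fin.
    rewrite -[X in (_ <= X / _ + _)%R](sqr_sqrtr (ltW (Gamma_gt0 s0))) -subr_ge0.
    set r := Num.sqrt _.
    (* AM-GM: the difference is [(r - G / c) ^ 2 / G] *)
    rewrite (_ : (_ - _)%R = ((r - tail Q s / c) ^+ 2 / tail Q s)%R); last first.
      by field; rewrite !gt_eqF.
    by rewrite divr_ge0 ?sqr_ge0// ltW.
- move=> s /=; rewrite in_itv/= andbT => s0.
  by rewrite lee_fin divr_ge0 ?Hnonneg// ltW// tail_gt0.
- exact/measurable_EFinP.
- move=> s _; rewrite lee_fin mulr_ge0 ?invr_ge0 ?sqr_ge0// ltW//.
  exact: tail_gt0.
- by apply/measurable_EFinP; exact: measurable_funM.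
Qed.

(** Monotonicity puts a rectangle of width [s] and height [sqrt (Gamma s)] under the graph, whose
    total area is [L]. *)
Lemma sqrt_Gamma_le_inv s : (0 < s)%R -> (Num.sqrt (Gam s) <= L / s)%R.
Proof.
move=> s0; rewrite ler_pdivlMr// -lee_fin -integral_sqrt_Gamma.
have -> : (Num.sqrt (Gam s) * s)%:E =
    \int[mu]_(t in `[0%R, s]) (Num.sqrt (Gam s))%:E.
  by rewrite integral_cst//= lebesgue_measure_itv/= lte_fin s0 oppr0 adde0.
apply: (@le_trans _ _ (\int[mu]_(t in `[0%R, s]) (Num.sqrt (Gam t))%:E)).
  apply: ge0_le_integral => //.
  - by apply/measurable_EFinP; apply: measurable_funS measurable_sqrt_Gamma => //;
      exact: subset_itvl.
  - move=> t /=; rewrite in_itv/= => /andP[t0 ts].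
    by rewrite lee_fin sqrt_Gamma_nonincreasing.
apply: ge0_subset_integral => //.
- exact/measurable_EFinP.
- exact: subset_itvl.
Qed.

Lemma sqrt_Gamma_cvgy : (Num.sqrt (Gam s) @[s --> +oo] --> (0 : R))%R.
Proof.
have inv0 : ((s : R)^-1 @[s --> +oo] --> (0 : R))%R.
  by apply/gtr0_cvgV0; [exact: nbhs_pinfty_gt|exact: cvg_id].
have Linv0 : (L / s @[s --> +oo] --> (0 : R))%R.
  by have := cvgM (cvg_cst L) inv0; rewrite mulr0; apply.
apply: (squeeze_cvgr _ (cvg_cst (0%R : R)) Linv0).
near=> s; have s0 : (0 < s)%R by near: s; exact: nbhs_pinfty_gt.
by rewrite sqrtr_ge0 sqrt_Gamma_le_inv.
Unshelve. all: by end_near. Qed.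

(* The tail [c * sqrt Gamma] is the equality case of [weighted_mean_ge]; it is
   at most [1] because [m] is small. *)
Lemma exists_equality_law (m : R) :
    (forall s, (0 <= s)%R -> (Gam t @[t --> s^'+] --> Gam s)%R) ->
    (0 < m)%R -> (m < L / Num.sqrt (Gam 0))%R ->
  exists2 Q, admissible P X g m Q &
    \int[mu]_(s in `[0%R, +oo[) (Gam s / tail Q s)%:E = (L ^+ 2 / m)%:E.
Proof.
move=> Gam_rc m0 mL; have L0 := sqrt_Gamma_mass_gt0.
pose c := (m / L)%R; have c0 : (0 < c)%R by rewrite divr_gt0.
have phi1 : (c * Num.sqrt (Gam 0) <= 1)%R.
  by rewrite -ler_pdivlMr ?sqrt_Gamma_gt0// ler_pdivrMr// mul1r mulrC ltW.
have phi_ni s t : (0 <= s)%R -> (s <= t)%R ->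
    (c * Num.sqrt (Gam t) <= c * Num.sqrt (Gam s))%R.
  by move=> s0 st; rewrite ler_pM2l// sqrt_Gamma_nonincreasing.
have phi_rc s : (0 <= s)%R ->
    (c * Num.sqrt (Gam t) @[t --> s^'+] --> c * Num.sqrt (Gam s))%R.
  move=> s0; apply: cvgM; first exact: cvg_cst.
  exact: cvg_comp (Gam_rc _ s0) (@sqrt_continuous R (Gam s)).
have phi_y : (c * Num.sqrt (Gam t) @[t --> +oo] --> (0 : R))%R.
  by have := cvgM (cvg_cst c) sqrt_Gamma_cvgy; rewrite mulr0; apply.
have [Q [Qpos Qtail]] := exists_law_of_tail phi1 phi_ni phi_rc phi_y.
have Qlaw : truncation_law Q.
  by split=> // s s0; rewrite Qtail// mulr_gt0// sqrt_Gamma_gt0.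
exists Q; first split => //.
- rewrite expectation_tail//.
  transitivity (\int[mu]_(s in `[0%R, +oo[) (c%:E * (Num.sqrt (Gam s))%:E)).
    by apply: eq_integral => s; rewrite inE/= in_itv/= andbT => s0; rewrite Qtail.
  rewrite ge0_integralZl//.
  + by rewrite integral_sqrt_Gamma -EFinM /c divfK// gt_eqF.
  + exact/measurable_EFinP.
  + by rewrite lee_fin ltW.
(* With this tail, the criterion is [1 / c] times the weighted integral of the standing
   assumption. *)
- apply/(randomized_sq_integrableE Qlaw).
  have -> : \int[mu]_(s in `[0%R, +oo[)
        ((tail Q s)^-1%:E * upper_moment P absh s) =
      \int[mu]_(s in `[0%R, +oo[) (c^-1%:E *
        ((Num.sqrt (Gam s))^-1%:E * upper_moment P absh s)).
    apply: eq_integral => s; rewrite inE/= in_itv/= andbT => s0.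
    by rewrite Qtail// muleA -EFinM invfM.
  rewrite ge0_integralZl//.
  + by rewrite lte_mul_pinfty// ?lee_fin ?invr_ge0 ?ltW// weighted_absm_lty.
  + move=> s _; apply: mule_ge0; last exact: absm_ge0.
    by rewrite lee_fin invr_ge0.
  + by rewrite lee_fin invr_ge0 ltW.
- transitivity (\int[mu]_(s in `[0%R, +oo[) (c^-1%:E * (Num.sqrt (Gam s))%:E)).
    apply: eq_integral => s; rewrite inE/= in_itv/= andbT => s0.
    rewrite Qtail// -EFinM; congr EFin.
    rewrite -{1}(sqr_sqrtr (ltW (Gamma_gt0 s0))).
    by field; rewrite !gt_eqF// sqrt_Gamma_gt0.
  rewrite ge0_integralZl//.
  + rewrite integral_sqrt_Gamma -EFinM; congr EFin; rewrite /c.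
    by field; rewrite !gt_eqF.
  + exact/measurable_EFinP.
  + by rewrite lee_fin invr_ge0 ltW.
Qed.

(** * Comparison of the two utilities *)

(** With [K] the absolute path moment, the squared mean and the variance are both at most the second
    moment, hence at most [K]; the squared bias is bounded by [(e - a)^2 <= 2 e^2 + 2 a^2]. The
    bound is uniform in [m]. *)
Lemma fixed_truncation_utility_ge (w m : R) : (0 <= w)%R ->
  (- (2 * fine abs_path_moment + 2 * fine (alpha P X g) ^+ 2)
   - w * fine abs_path_moment)%:E
  <= utility P X g P w (fixed_truncation X g m).
Proof.
move=> w0.
pose F (z : T * measurableTypeR R) : R := if (z.2 <= m :> R)%R then h z else 0%R.
have mF : measurable_fun setT F.
  apply: measurable_fun_ifT => //; apply: measurable_fun_ler => //.
have Fh x : \int[mu]_s `|F (x, s)|%:E <= \int[mu]_s `|h (x, s)|%:E.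
  have mFx (u : T * measurableTypeR R -> R) : measurable_fun setT u ->
      measurable_fun setT (fun s : measurableTypeR R => `|u (x, s)|%:E).
    move=> mu_; apply/measurable_EFinP; apply: measurableT_comp => //.
    by apply: (measurableT_comp mu_); exact: pair1_measurable.
  apply: ge0_le_integral => //.
  - exact: mFx.
  - exact: (mFx h).
  - by move=> s _; rewrite lee_fin /F/=; case: ifP => // _; rewrite normr0.
have mpath (u : T * measurableTypeR R -> R) : measurable_fun setT u ->
    measurable_fun setT (fun x => (\int[mu]_s `|u (x, s)|%:E) ^+ 2).
  move=> mu_; apply: emeasurable_funM;
    apply: (measurable_parametric_integral mu (f := fun z => `|u z|%:E));
    by apply/measurable_EFinP; exact: measurableT_comp.
have pathF_ge0 x : 0 <= \int[mu]_s `|F (x, s)|%:E.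
  by apply: integral_ge0 => s _; rewrite lee_fin.
have Foo : \int[P]_x (\int[mu]_s `|F (x, s)|%:E) ^+ 2 <= abs_path_moment.
  apply: ge0_le_integral => //.
  - by move=> x _; apply: mule_ge0.
  - exact: (mpath F).
  - exact: (mpath h).
  - by move=> x _; apply: lee_pmul.
have Flty := le_lt_trans Foo abs_path_moment_lty.
have fE : fixed_truncation X g m = (fun x => \int[mu]_s F (x, s))%R.
  apply/funext => x; rewrite /fixed_truncation Rintegral_mkcond.
  apply: eq_Rintegral => s _; rewrite patchE mem_setE in_itv/= /F/=.
  case: (leP 0%R s) => s0 /=; first by rewrite ext_pathE.
  by rewrite ext_path_lt0// if_same.
have L2 : fixed_truncation X g m \in Lfun P 2%:E.
  by rewrite fE; exact: fine_path_integral_Lfun2.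
have L1 := Lfun_subset12 (fin_num_measure P setT measurableT) L2.
have Efin := expectation_fin_num L1.
have Vfin := variance_fin_num L2.
have E2fin := expectation_fin_num (Lfun2_mul_Lfun1 L2 L2).
have E2K : 'E_P[fixed_truncation X g m ^+ 2] <= abs_path_moment.
  apply: le_trans Foo; rewrite unlock fE.
  under eq_integral do rewrite fctE.
  apply: ge0_le_integral => //.
  - by move=> x _; rewrite lee_fin sqr_ge0.
  - apply/measurable_EFinP; apply: measurable_funX.
    exact: measurable_fine_path_integral.
  - exact: (mpath F).
  - move=> x _; rewrite expe2; apply: fine_sqr_le.
    apply: le_abse_integral => //; apply/measurable_EFinP.
    by apply: (measurableT_comp mF); exact: pair1_measurable.
have Kfin : abs_path_moment \is a fin_num.
  rewrite ge0_fin_numE ?abs_path_moment_lty// /abs_path_moment.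
  by apply: integral_ge0 => x _; apply: mule_ge0; apply: integral_ge0.
have V0 := variance_ge0 P (fixed_truncation X g m).
have VE := varianceE L2.
rewrite /utility; move: E2K V0 VE.
rewrite -(fineK Kfin) -(fineK alpha_fin_num) -(fineK Efin) -(fineK Vfin) -(fineK E2fin).
rewrite -EFinB -!EFin_expe -EFinN -EFinM -!EFinB !lee_fin => E2K V0 [VE].
move: E2K V0 VE => /=.
move: (fine 'V_P[_]) (fine 'E_P[_]) (fine 'E_P[_]) (fine abs_path_moment)
  (fine (alpha P X g)) => v e e2 k a e2k v0 ve.
have ek : (e ^+ 2 <= k)%R by rewrite expr2; lra.
have wv : (w * v <= w * k)%R.
  by rewrite ler_wpM2l// (le_trans _ e2k)// ve gerBl -expr2 sqr_ge0.
have ea : (0 <= (e + a) ^+ 2)%R by exact: sqr_ge0.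
by nra.
Qed.

(** The equality law attains the lower bound, so it is optimal. The bound is stated for every
    admissible law, hence applies to any optimal law, whether or not it is this one. *)
Lemma optimal_law_gap (m : R) :
    (forall s, (0 <= s)%R -> (Gam t @[t --> s^'+] --> Gam s)%R) ->
    (0 < m)%R -> (m < L / Num.sqrt (Gam 0))%R ->
  (exists Q, optimal P X g m Q) /\
  (forall Q, admissible P X g m Q ->
    (2 * (L ^+ 2 / m) - fine (alpha P X g) ^+ 2)%:E <= randomized_variance P X g Q).
Proof.
move=> Gam_rc m0 mL.
have lower Q : admissible P X g m Q ->
    (2 * (L ^+ 2 / m) - fine (alpha P X g) ^+ 2)%:E <= randomized_variance P X g Q.
  move=> [Qlaw QN Qint]; have [V VE ->] := randomized_varianceE Qlaw Qint.
  have := weighted_mean_ge Qlaw m0 QN; rewrite VE !lee_fin => LV.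
  by rewrite lerB// ler_pM2l.
split=> //; have [Q Qadm QE] := exists_equality_law Gam_rc m0 mL.
exists Q; split=> // Q' /lower; apply: le_trans.
case: (Qadm) => Qlaw _ Qint; have [V VE ->] := randomized_varianceE Qlaw Qint.
by move: VE; rewrite QE => -[->].
Qed.

End truncation_moments.

(** The difference quotient converges while [t - s] tends to 0. Approaching from the right stays
    inside the half-line, where [D 0] is known to equal [f], and includes the endpoint [s = 0]. *)
Lemma smooth_halfline_right_continuous (R : realType) (f : R -> R) (s : R) :
  smooth_halfline f -> 0 <= s -> f t @[t --> s^'+] --> f s.
Proof.
move=> [D [D0 Dlim]] s0.
have finer : s^'+ `=>` within `[0, +oo[ s^'.
  move=> A wA.
  have {}wA : nbhs s (fun t => t != s -> `[0, +oo[%classic t -> A t) by exact: wA.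
  suff: nbhs s (fun t => s < t -> A t) by [].
  apply: filterS wA => t tA st.
  by apply: tA; rewrite /= ?gt_eqF// in_itv/= andbT (le_trans s0)// ltW.
have quot : (D 0%N t - D 0%N s) / (t - s) @[t --> s^'+] --> D 1%N s.
  by apply: cvg_trans (Dlim 0%N s s0); exact: cvg_app.
have step : t - s @[t --> s^'+] --> s - s.
  by apply: cvgB; [exact: cvg_within|exact: cvg_cst].
have lim : (D 0%N t - D 0%N s) / (t - s) * (t - s) + f s @[t --> s^'+] -->
    D 1%N s * (s - s) + f s.
  by apply: cvgD; [exact: cvgM|exact: cvg_cst].
rewrite subrr mulr0 add0r in lim; apply: cvg_trans lim.
apply: near_eq_cvg; near=> t.
have st : s < t by near: t; exact: nbhs_right_gt.
by rewrite divfK ?subr_eq0 ?gt_eqF// !D0 ?(le_trans s0 (ltW st))// subrK.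
Unshelve. all: by end_near. Qed.

(** Existence of an optimal law is part of the conclusion, so the inequality over all optimal laws
    is not vacuous. *)
Theorem proposition1 (R : realType) (d : measure_display)
    (T : measurableType d) (P : probability T R)
    (S : metricType R) (X : R -> T -> S) (g : S -> R -> R)
    (HX : is_process X)
    (Hg : jointly_measurable X g)
    (Hint : standing_integrability P X g)
    (Hnonneg : forall s : R, 0 <= s -> 0 <= Gamma P X g s)
    (Hdecr : forall s t : R, 0 <= s -> s < t ->
               Gamma P X g t < Gamma P X g s)
    (Hsmooth : smooth_halfline (Gamma P X g))
    (w : R) (Hw : 0 < w) :
  exists2 m0 : R, 0 < m0 &
    forall m : R, 0 < m -> m < m0 ->
      (exists Qstar : probability (measurableTypeR R) R,
         optimal P X g m Qstar) /\
      (forall Qstar : probability (measurableTypeR R) R,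
         optimal P X g m Qstar ->
         (utility P X g (joint P Qstar) w (randomized_truncation X g Qstar)
          < utility P X g P w (fixed_truncation X g m))%E).
Proof.
have Gam_rc s : 0 <= s -> Gamma P X g t @[t --> s^'+] --> Gamma P X g s.
  exact: smooth_halfline_right_continuous.
have L0 := sqrt_Gamma_mass_gt0 Hg Hint Hnonneg Hdecr.
have r0 := sqrt_Gamma_gt0 Hnonneg Hdecr (lexx 0).
set L := sqrt_Gamma_mass P X g in L0.
set a := fine (alpha P X g); set K := fine (abs_path_moment P X g).
have K0 : 0 <= K.
  apply: fine_ge0; apply: integral_ge0 => x _.
  by apply: mule_ge0; apply: integral_ge0.
(* The terms without [w * a ^+ 2] and 1 offset the lower bound for fixed truncation, [w * a ^+ 2]
   offsets the squared mean in the variance, and 1 keeps [D] positive as a divisor. *)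
pose D := 2 * K + 2 * a ^+ 2 + w * K + w * a ^+ 2 + 1.
have wK0 : 0 <= w * K by rewrite mulr_ge0// ltW.
have wa0 : 0 <= w * a ^+ 2 by rewrite mulr_ge0 ?sqr_ge0// ltW.
have D0 : 0 < D by have := sqr_ge0 a; rewrite /D; lra.
(* Below the first threshold the equality law exists; below the second, [2 w L^2 / m] exceeds
   [D]. *)
exists (Num.min (L / Num.sqrt (Gamma P X g 0)) (2 * w * L ^+ 2 / D)).
  by rewrite lt_min !divr_gt0// ?mulr_gt0 ?exprn_gt0.
move=> m m0; rewrite lt_min => /andP[mL mD].
have [ex_opt gap] := optimal_law_gap Hg Hint Hnonneg Hdecr Gam_rc m0 mL.
split=> // Q [/[dup] Qadm [Qlaw _ Qint] _].
apply: lt_le_trans (fixed_truncation_utility_ge Hg Hint Hnonneg Hdecr m (ltW Hw)).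
have := gap _ Qadm.
have [V _ QV] := randomized_varianceE Hg Hint Hnonneg Hdecr Qlaw Qint.
rewrite /utility (randomized_mean Hg Hint Hnonneg Hdecr Qlaw Qint).
rewrite subee ?(alpha_fin_num Hg Hint Hnonneg Hdecr)//.
move: QV; rewrite /randomized_variance => ->; set v := 2 * V - _.
rewrite lee_fin -/L -/a -/K => gapv.
rewrite expe2 mule0 oppe0 add0e -EFinM -EFinN lte_fin.
have big : D < 2 * w * L ^+ 2 / m.
  by rewrite ltr_pdivlMr// mulrC -ltr_pdivlMr.
have wv : w * (2 * (L ^+ 2 / m) - a ^+ 2) <= w * v by rewrite ler_pM2l.
have -> : - (2 * K + 2 * a ^+ 2) - w * K = w * a ^+ 2 + 1 - D by rewrite /D; ring.
have e : w * (2 * (L ^+ 2 / m) - a ^+ 2) = 2 * w * L ^+ 2 / m - w * a ^+ 2 by ring.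
by rewrite e in wv; lra.
Qed.
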